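(* The only pair $(n,x)$ of positive integers with $n\geq 2$ satisfying $(4^{n}-2)(100^{n}-2)=x^{2}$ is $(n,x)=(3,7874)$. *)

(* Defs.v *)
From Stdlib Require Export ZArith.

(* Main.v *)
Require Import Defs.
From Stdlib Require Import ZArith.
From Stdlib Require Import Znumtheory Zpow_facts Lia Classical.

(** Write [H = 2^(n-1)], so that [x = 2 y] and
    [(2 H^2 - 1) (2 H^2 25^n - 1) = y^2].  The two factors then have the same
    squarefree part, so they are of the form [D u^2] and [D v^2].  Hence
    [(H, u)] and [(H 5^n, v)] both solve [2 X^2 - D Y^2 = 1].  Every solution
    is an odd multiple, in each coordinate, of the minimal one [(X0, Y0)]; as
    [H] is a power of 2, this forces [X0 = H].  Dividing the second solution by
    the minimal one gives [a s^2 - (a - 1) t^2 = 1] with [a = 2 H^2] and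
    [s = 5^n].  The solutions [s > 1] of this equation start with [4 a - 3], and
    the next one exceeds [16 (a - 1)^2 > 5^n].  So [5^n = 2 * 4^n - 3], which
    holds only for [n = 3]. *)

Local Open Scope Z_scope.

(** * Coprime factors of squares *)

Lemma coprime_cofactors (a b : Z) : a <> 0 ->
  exists d a' b', 0 < d /\ a = a' * d /\ b = b' * d /\ Z.gcd a' b' = 1.
Proof.
intros Ha.
destruct (Z.gcd_divide_l a b) as [a' Ea], (Z.gcd_divide_r a b) as [b' Eb].
assert (Hd : Z.gcd a b <> 0) by (intro E; apply Z.gcd_eq_0_l in E; lia).
exists (Z.gcd a b), a', b'. repeat split; try assumption.
- pose proof (Z.gcd_nonneg a b). lia.
- rewrite <- (Z.gcd_div_gcd a b _ Hd eq_refl).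
  f_equal; symmetry; [rewrite Ea at 1|rewrite Eb at 1]; now apply Z.div_mul.
Qed.

Lemma divide_of_sqr_divide (g y : Z) : g <> 0 -> (g * g | y * y) -> (g | y).
Proof.
intros Hg [q Hq].
destruct (coprime_cofactors g y Hg) as (d & g' & y' & Hd & Eg & Ey & C).
assert (E : y' * y' = q * g' * g').
{ apply (Z.mul_reg_l _ _ (d * d)); [nia|]. rewrite Eg, Ey in Hq. nia. }
assert (D1 : (g' | y')).
{ apply (Z.gauss _ y'); [|exact C]. exists (q * g'). lia. }
destruct D1 as [r Hr]. exists r. rewrite Ey, Eg, Hr. ring.
Qed.

(** Write [m = m' u] and [w = w' u] with [m'], [w'] coprime, so that [m' k = u w'^2]. Then [m']
    divides [u] by coprimality to [w'], and [u] divides [m'] by coprimality to [k]. *)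
Lemma coprime_mul_eq_sqr (m k w : Z) :
  0 < m -> 0 < k -> Z.gcd m k = 1 -> m * k = w * w ->
  exists u v, 0 < u /\ 0 <= v /\ m = u * u /\ k = v * v.
Proof.
intros Hm Hk C E.
destruct (coprime_cofactors m w) as (u & m' & w' & Hd & Em & Ew & C');
  [lia|].
assert (E' : m' * k = u * (w' * w')).
{ apply (Z.mul_reg_l _ _ u); [lia|]. rewrite Em, Ew in E. nia. }
assert (D1 : (m' | u)).
{ apply (Z.gauss _ w'); [|exact C']. apply (Z.gauss _ w'); [|exact C'].
  exists k. lia. }
assert (D2 : (u | m')).
{ apply (Z.gauss _ k).
  - exists (w' * w'). lia.
  - apply Z.divide_1_r_nonneg; [apply Z.gcd_nonneg|]. rewrite <- C.
    apply Z.gcd_greatest; [|apply Z.gcd_divide_r].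
    apply Z.divide_trans with u; [apply Z.gcd_divide_l|].
    exists m'. exact Em. }
assert (m' = u) by (apply Z.divide_antisym_nonneg; [nia|lia|exact D1|exact D2]).
subst m'. exists u, (Z.abs w'). repeat split; try lia.
apply (Z.mul_reg_l _ _ u); [lia|]. nia.
Qed.

(** Take for [D] the gcd of [M] and [N], squarefree or not: the cofactors are coprime and their
    product is the square of [y / D]. *)
Lemma mul_eq_sqr_common_part (M N y : Z) :
  0 < M -> 0 < N -> M * N = y * y ->
  exists D u v, 0 < D /\ 0 < u /\ 0 <= v /\ M = D * (u * u) /\ N = D * (v * v).
Proof.
intros HM HN E.
destruct (coprime_cofactors M N) as (g & m & k & Hd & Em & Ek & C); [lia|].
assert (Dy : (g | y)).
{ apply divide_of_sqr_divide; [lia|]. exists (m * k).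
  rewrite <- E, Em, Ek. ring. }
destruct Dy as [w Hw].
destruct (coprime_mul_eq_sqr m k w) as (u & v & Hu & Hv & Eu & Ev);
  [nia|nia|exact C| |].
- apply (Z.mul_reg_l _ _ (g * g)); [nia|]. rewrite Em, Ek, Hw in E. nia.
- exists g, u, v. repeat split; try lia.
Qed.

(** * The equation [2 X^2 - D Y^2 = 1] *)

Definition pell2 (D X Y : Z) : Prop :=
  0 < X /\ 0 <= Y /\ 2 * (X * X) - D * (Y * Y) = 1.

(* Multiplication of [X sqrt 2 + Y sqrt D] by [(X0 sqrt 2 - Y0 sqrt D)^2]. *)
Lemma pell2_descent (D X0 Y0 X Y : Z) :
  0 < D -> pell2 D X0 Y0 -> pell2 D X Y -> X0 < X ->
  let X' := X * (4 * (X0 * X0) - 1) - 2 * X0 * Y0 * Y * D in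
  let Y' := Y * (4 * (X0 * X0) - 1) - 4 * X0 * Y0 * X in
  X' < X /\ pell2 D X' (Z.abs Y').
Proof.
intros HD (HX0 & HY0 & E0) (HX & HY & E) Hlt X' Y'.
(* The multiplier [(X0 sqrt 2 - Y0 sqrt D)^2] equals [4 X0^2 - 1 - 2 X0 Y0 sqrt (2 D)]; [P] says
   that its norm is 1. *)
assert (P : (4 * (X0 * X0) - 1) * (4 * (X0 * X0) - 1)
            = 1 + 8 * D * (X0 * X0) * (Y0 * Y0)).
{ replace (D * (Y0 * Y0)) with (2 * (X0 * X0) - 1) by lia.
  replace (8 * D * (X0 * X0) * (Y0 * Y0))
    with (8 * (X0 * X0) * (D * (Y0 * Y0))) by ring.
  replace (D * (Y0 * Y0)) with (2 * (X0 * X0) - 1) by lia. ring. }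
repeat split.
(* The ratio [Y / X] grows with [X], since [D (Y / X)^2 = 2 - 1 / X^2]. *)
- assert (L : X * Y0 < X0 * Y).
  { apply Z.square_lt_simpl_nonneg; [nia|].
    apply (Zmult_lt_reg_r _ _ D HD).
    replace (X * Y0 * (X * Y0) * D) with (X * X * (D * (Y0 * Y0))) by ring.
    replace (X0 * Y * (X0 * Y) * D) with (X0 * X0 * (D * (Y * Y))) by ring.
    replace (D * (Y0 * Y0)) with (2 * (X0 * X0) - 1) by lia.
    replace (D * (Y * Y)) with (2 * (X * X) - 1) by lia. nia. }
  assert (0 < Y0) by nia.
  assert (K : D * Y0 * (X * Y0) < D * Y0 * (X0 * Y))
    by (apply Z.mul_lt_mono_pos_l; nia).
  replace (D * Y0 * (X * Y0)) with (X * (D * (Y0 * Y0))) in K by ring.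
  replace (D * (Y0 * Y0)) with (2 * (X0 * X0) - 1) in K by lia.
  unfold X'. lia.
- apply Z.lt_0_sub. apply Z.square_lt_simpl_nonneg; [nia|].
  replace (2 * X0 * Y0 * Y * D * (2 * X0 * Y0 * Y * D))
    with (4 * D * (X0 * X0) * (Y0 * Y0) * (D * (Y * Y))) by ring.
  replace (D * (Y * Y)) with (2 * (X * X) - 1) by lia.
  replace (X * (4 * (X0 * X0) - 1) * (X * (4 * (X0 * X0) - 1)))
    with (X * X * ((4 * (X0 * X0) - 1) * (4 * (X0 * X0) - 1))) by ring.
  rewrite P.
  assert (0 <= D * (X0 * X0) * (Y0 * Y0)) by nia. nia.
- apply Z.abs_nonneg.
- rewrite Z.abs_square.
  transitivity ((2 * (X * X) - D * (Y * Y))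
    * ((4 * (X0 * X0) - 1) * (4 * (X0 * X0) - 1)
       - 8 * D * (X0 * X0) * (Y0 * Y0))).
  + unfold X', Y'. ring.
  + rewrite P, E. ring.
Qed.

Lemma pell2_minimal (D X Y : Z) : pell2 D X Y ->
  exists X0 Y0, pell2 D X0 Y0 /\ forall X1 Y1, pell2 D X1 Y1 -> X0 <= X1.
Proof.
intros S. assert (HX : 0 <= X) by (destruct S; lia).
revert Y S; pattern X; apply Z_lt_induction; [|exact HX].
clear X HX; intros X IH Y S.
destruct (classic (exists X1 Y1, pell2 D X1 Y1 /\ X1 < X))
  as [(X1 & Y1 & S1 & L)|N].
- apply (IH X1) with Y1; [|exact S1]. destruct S1; lia.
- exists X, Y. split; [exact S|]. intros X1 Y1 S1.
  destruct (Z.le_gt_cases X X1) as [|L]; [assumption|].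
  exfalso; apply N; eauto.
Qed.

(** Strong induction on [X]. For the descended pair [(X', Y')], [X + X'] is a multiple of [2 X0] and
    [Y - Y'] one of [2 Y0], so odd multiples lift back to [(X, Y)]. *)
Lemma pell2_odd_multiple (D X0 Y0 : Z) : 0 < D -> pell2 D X0 Y0 ->
  (forall X Y, pell2 D X Y -> X0 <= X) ->
  forall X Y, pell2 D X Y ->
  exists s t, X = X0 * (2 * s + 1) /\ Y = Y0 * (2 * t + 1).
Proof.
intros HD S0 Hmin X Y S.
assert (HX : 0 <= X) by (destruct S; lia).
revert Y S; pattern X; apply Z_lt_induction; [|exact HX].
clear X HX; intros X IH Y S.
destruct (Z.lt_trichotomy X0 X) as [L|[<-|L]].
- destruct (pell2_descent D X0 Y0 X Y HD S0 S L) as [L' S'].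
  assert (R : 0 <= X * (4 * (X0 * X0) - 1) - 2 * X0 * Y0 * Y * D < X)
    by (destruct S'; lia).
  destruct (IH _ R _ S') as (s & t & Es & Et).
  destruct S0 as (_ & _ & E0).
  exists (2 * X0 * X - Y0 * Y * D - s - 1).
  assert (EY : forall t', Y * (4 * (X0 * X0) - 1) - 4 * X0 * Y0 * X
                = Y0 * (2 * t' + 1) ->
    Y = Y0 * (2 * (t' - D * Y0 * Y + 2 * X0 * X) + 1)).
  { intros t' H.
    replace (4 * (X0 * X0) - 1) with (1 + 2 * (D * (Y0 * Y0))) in H by lia.
    lia. }
  (* Descent controls [Y'] only up to sign; the opposite of [2 t + 1] is [2 (- t - 1) + 1]. *)
  match type of Et with Z.abs ?z = _ =>
    destruct (Z.abs_eq_or_opp z) as [A|A] end; rewrite A in Et.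
  + exists (t - D * Y0 * Y + 2 * X0 * X). split; [lia|apply EY; exact Et].
  + exists (- t - 1 - D * Y0 * Y + 2 * X0 * X).
    split; [lia|apply EY; lia].
- exists 0, 0. destruct S0 as (? & ? & ?), S as (? & ? & ?). split; [lia|].
  assert (Y * Y = Y0 * Y0) by (apply (Z.mul_reg_l _ _ D); lia). nia.
- apply Hmin in S. lia.
Qed.

(** * The equation [a s^2 - (a - 1) t^2 = 1] *)

(** Reduction modulo 2 makes [t] odd, like [s]; the form [(a - 1) (t^2 - s^2) = s^2 - 1] then makes
    [|t| - s] even and positive. *)
Lemma pell_consecutive_shift (a s t : Z) : 2 <= a -> Z.even a = true ->
  Z.odd s = true -> 1 < s -> a * (s * s) - (a - 1) * (t * t) = 1 ->
  exists e, 0 < e /\ Z.abs t = s + 2 * e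
            /\ 4 * (a - 1) * e * (s + e) = s * s - 1.
Proof.
intros Ha Ea Os Hs E.
assert (Ot : Z.odd (Z.abs t) = true).
{ apply (f_equal Z.odd) in E. rewrite Z.odd_sub, !Z.odd_mul, Z.odd_sub in E.
  rewrite <- !Z.negb_even, Ea, !Z.negb_even in E. cbn in E.
  destruct (Z.abs_eq_or_opp t) as [->| ->]; [|rewrite Z.odd_opp];
    now destruct (Z.odd t). }
assert (Et : t * t = Z.abs t * Z.abs t) by (symmetry; apply Z.abs_square).
pose proof (Z.abs_nonneg t) as Ht. rewrite Et in E.
set (r := Z.abs t) in *; clearbody r.
assert (L : s < r).
{ apply Z.square_lt_simpl_nonneg; [exact Ht|].
  apply (Zmult_lt_reg_r _ _ (a - 1)); [lia|]. assert (1 < s * s) by nia. lia. }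
apply Z.odd_spec in Os as [p Hp]; apply Z.odd_spec in Ot as [q Hq].
exists (q - p). repeat split; [lia|lia|].
replace r with (s + 2 * (q - p)) in E by lia. lia.
Qed.

(** Descend once, to [s' = s - 4 (a - 1) e] with [s s' = 1 + 4 (a - 1) e^2]. If [s' = 1], then
    [e = 1]. Otherwise [s'] has a shift of its own, which gives [s' > 4 (a - 1)], hence
    [4 (a - 1) e < s <= e^2]. *)
Lemma pell_consecutive_gap (a s t : Z) : 2 <= a -> Z.even a = true ->
  Z.odd s = true -> 1 < s -> a * (s * s) - (a - 1) * (t * t) = 1 ->
  s = 4 * a - 3 \/ 16 * ((a - 1) * (a - 1)) < s.
Proof.
intros Ha Ea Os Hs E.
destruct (pell_consecutive_shift a s t Ha Ea Os Hs E) as (e & He & _ & F).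
(* [(s', t')] represents [(s sqrt a + t sqrt (a - 1)) (sqrt a - sqrt (a - 1))^2]. *)
pose (s' := s - 4 * (a - 1) * e). pose (t' := 2 * (2 * a - 1) * e - s).
assert (P : s * s' = 1 + 4 * (a - 1) * (e * e)) by (unfold s'; lia).
assert (Hs' : 1 <= s') by nia.
assert (E' : a * (s' * s') - (a - 1) * (t' * t') = 1)
  by (unfold s', t'; lia).
destruct (Z.eq_dec s' 1) as [S1|S1].
- left. rewrite S1 in P.
  assert (K : (a - 1) * e * (e - 1) = 0) by (unfold s' in S1; lia).
  apply Z.mul_eq_0_r in K; [|nia]. assert (e = 1) by lia.
  subst e; unfold s' in S1; lia.
- right.
  assert (Os' : Z.odd s' = true).
  { unfold s'. rewrite Z.odd_sub, Os, !Z.odd_mul. reflexivity. }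
  destruct (pell_consecutive_shift a s' t' Ha Ea Os' ltac:(lia) E')
    as (e' & He' & _ & F').
  assert (B : 4 * (a - 1) <= s' - 1).
  { apply (Zmult_le_reg_r _ _ (s' + 1)); [lia|].
    assert (1 * (s' + 1) <= e' * (s' + e')) by (apply Z.mul_le_mono_nonneg; lia).
    apply (Z.mul_le_mono_nonneg_l _ _ (4 * (a - 1))) in H; lia. }
  assert (s <= e * e).
  { apply (Zmult_le_reg_r _ _ (4 * (a - 1))); [lia|].
    apply (Z.mul_le_mono_nonneg_l _ _ s) in B; lia. }
  assert (4 * (a - 1) * e < s) by (unfold s' in Hs'; lia).
  assert (L : 4 * (a - 1) < e) by (apply (Zmult_lt_reg_r _ _ e); lia).
  apply (Z.mul_lt_mono_pos_l (4 * (a - 1))) in L; lia.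
Qed.

Lemma pow5_eq (n : Z) : 2 <= n -> 5 ^ n = 2 * 4 ^ n - 3 -> n = 3.
Proof.
intros Hn E.
destruct (Z.eq_dec n 2) as [->|]; [cbn in E; lia|].
destruct (Z.eq_dec n 3) as [|]; [assumption|exfalso].
(* The induction starts from [2 * 4^4 = 512 < 625 = 5^4]. *)
assert (G : forall k, 0 <= k -> 2 * 4 ^ (4 + k) < 5 ^ (4 + k)).
{ apply natlike_ind; [reflexivity|]. intros k Hk IH.
  rewrite Z.add_succ_r, !Z.pow_succ_r by lia. lia. }
specialize (G (n - 4) ltac:(lia)).
replace (4 + (n - 4)) with n in G by lia. lia.
Qed.

Lemma odd_divisor_pow2 (k s q : Z) : 0 <= k -> Z.odd s = true -> 0 < s ->
  2 ^ k = q * s -> s = 1.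
Proof.
intros Hk Os Hs E.
destruct (Zdivide_power_2 s 2 k) as [m ->];
  [exact Hk|lia|exact prime_2|now exists q|].
destruct (Z.lt_trichotomy m 0) as [N|[->|P]]; [|reflexivity|].
(* For negative [m], [2 ^ m] is [0] by convention, against [0 < s]. *)
- rewrite Z.pow_neg_r in Hs by exact N. lia.
- rewrite Z.odd_pow in Os by exact P. discriminate.
Qed.

Theorem corollary28 (n x : Z) (hn : (2 <= n)%Z) (hx : (0 < x)%Z) :
  ((4 ^ n - 2) * (100 ^ n - 2) = x ^ 2)%Z <-> (n = 3 /\ x = 7874)%Z.
Proof.
split; [|intros [-> ->]; reflexivity].
intros E.
pose (H := 2 ^ (n - 1)). pose (F := 5 ^ n).
assert (E2 : 2 ^ n = 2 * H)
  by (unfold H; rewrite <- Z.pow_succ_r by lia; f_equal; lia).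
assert (E4 : 4 ^ n = 4 * (H * H)).
{ change 4 with (2 * 2) at 1. rewrite Z.pow_mul_l, E2. ring. }
assert (E100 : 100 ^ n = 4 * (H * H) * (F * F)).
{ change 100 with (4 * (5 * 5)). rewrite !Z.pow_mul_l, E4. reflexivity. }
assert (HH : 2 <= H) by (apply (Z.pow_le_mono_r 2 1); lia).
assert (HF : 25 <= F) by (apply (Z.pow_le_mono_r 5 2); lia).
assert (HHF : 2 <= H * F) by nia.
assert (Hn3 : n = 3).
{ rewrite E4, E100, Z.pow_2_r in E.
  assert (Dx : (2 | x)).
  { assert (D : (2 | x * x)) by (rewrite <- E; exists
      ((2 * (H * H) - 1) * (4 * (H * H) * (F * F) - 2)); ring).
    apply prime_mult in D; [tauto|exact prime_2]. }
  destruct Dx as [y ->].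
  destruct (mul_eq_sqr_common_part (2 * (H * H) - 1)
    (2 * ((H * F) * (H * F)) - 1) y) as (D & u & v & HD & Hu & Hv & Eu & Ev);
    [clear - HH; nia|clear - HHF; nia|lia|].
  assert (Su : pell2 D H u) by (repeat split; lia).
  assert (Sv : pell2 D (H * F) v) by (repeat split; lia).
  destruct (pell2_minimal D H u Su) as (X0 & Y0 & S0 & Hmin).
  destruct (pell2_odd_multiple D X0 Y0 HD S0 Hmin H u Su) as (p & _ & EH & _).
  destruct (pell2_odd_multiple D X0 Y0 HD S0 Hmin (H * F) v Sv)
    as (q & t & _ & Et).
  destruct S0 as (HX0 & HY0 & E0).
  assert (Hp : 2 * p + 1 = 1).
  { apply (odd_divisor_pow2 (n - 1) _ X0); [lia| |clear - EH HH HX0; nia|exact EH].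
    apply Z.odd_spec; now exists p. }
  rewrite Hp, Z.mul_1_r in EH. subst X0.
  pose (a := 2 * (H * H)).
  assert (EF : a * (F * F) - (a - 1) * ((2 * t + 1) * (2 * t + 1)) = 1).
  (* As [X0 = H], the minimal solution satisfies [D Y0^2 = a - 1]. *)
  { replace (a - 1) with (D * (Y0 * Y0)) by (unfold a; lia).
    destruct Sv as (_ & _ & Sv). rewrite Et in Sv. unfold a. lia. }
  assert (Ha : 8 <= a) by (unfold a; clear - HH; nia).
  assert (Ea : Z.even a = true) by (unfold a; now rewrite Z.even_mul).
  apply pow5_eq; [exact hn|]. fold F. rewrite E4.
  destruct (pell_consecutive_gap a F (2 * t + 1)) as [K|K];
    [lia|exact Ea|unfold F; now rewrite Z.odd_pow by lia|lia|exact EF| |].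
  - unfold a in K; lia.
  - exfalso.
    (* The crude bound [5^n <= 16^n = 4 a^2] suffices, because [4 a^2 < 16 (a - 1)^2] for
       [a >= 8]. *)
    assert (F16 : F <= 16 ^ n) by (apply Z.pow_le_mono_l; lia).
    assert (E16 : 16 ^ n = (2 * a) * (2 * a)).
    { change 16 with (4 * 4). rewrite Z.pow_mul_l, E4. unfold a; ring. }
    rewrite E16 in F16. clear - K Ha F16. nia. }
(* At [n = 3] the left side is [62 * 999998 = 61999876]. *)
split; [exact Hn3|]. subst n. change (61999876 = x ^ 2) in E. nia.
Qed.
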